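(* Consider the parameterized family of continuous-time Markov decision processes described in the context, with fixed baseline parameter $\theta\in\Theta$. For all $\pi\in\Pi$, $\tau>0$ and $\varepsilon\ge0$, $$\inf_{\tilde\theta\in\widetilde{\mathcal C}^\pi_{\tau,\varepsilon}(\theta)}\mathbb E_\rho^{\mathbb P^\pi_{\tilde\theta}}\Big[\int_0^\infty e^{-rt}\sum_{a\in\mathcal A_{S_t}}\pi(a|S_t)R_{\tilde\theta}(S_t,a)\,\mathrm dt\Big]$$ $$\ge\ \exp\Big(r\,\mathbb E_\rho^{\mathbb P^\pi_\theta}\Big[\int_0^\infty e^{-rt}\Big(\sum_{a\in\mathcal A_{S_t}}\pi(a|S_t)\log R_\theta(S_t,a)-\tau\,\mathrm{KL}(\pi\|\mu)(S_t)\Big)\mathrm dt\Big]-\varepsilon-\log r\Big),$$ where $$\widetilde{\mathcal C}^\pi_{\tau,\varepsilon}(\theta):=\Big\{\tilde\theta\in\Theta\ \Big|\ \tau\log\Big[\sum_{s\in\mathcal S}\bar{\mathrm d}^\pi_{\rho,\theta}(s)\sum_{a\in\mathcal A_s}\mu(a|s)\exp\Big(\frac{f_{\theta,\tilde\theta}(s,a)}{\tau}\Big)\Big]\le\varepsilon\Big\},$$ $$f_{\theta,\tilde\theta}(s,a):=\log\frac{\bar{\mathrm d}^\pi_{\rho,\theta}(s)}{\bar{\mathrm d}^\pi_{\rho,\tilde\theta}(s)}-\log\frac{R_{\tilde\theta}(s,a)}{R_\theta(s,a)}.$$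
   Context: $\mathcal S$ and $\mathcal A$ are finite state and action spaces; for each $s\in\mathcal S$, $\mathcal A_s\subseteq\mathcal A$ is a nonempty set of available actions. $\Theta$ is a parameter set. For each $\vartheta\in\Theta$, $s\in\mathcal S$, $a\in\mathcal A_s$ there are transition rates $\lambda^a_{ss',\vartheta}\ge 0$ for $s'\ne s$, with $\lambda^a_{ss,\vartheta}=-\sum_{s'\neq s}\lambda^a_{ss',\vartheta}$, and a reward function $R_\vartheta:\mathcal S\times\mathcal A\to(0,\infty)$. A baseline $\theta\in\Theta$ is fixed. The policy class is $\Pi:=\{\pi:\mathcal S\to\mathcal P(\mathcal A)\mid \sum_{a\in\mathcal A_s}\pi(a|s)=1\ \forall s\in\mathcal S\}$, where $\mathcal P(\cdot)$ denotes probability measures. Fix an initial distribution $\rho\in\mathcal P(\mathcal S)$ and a discount rate $r>0$. For $\pi\in\Pi$ and $\vartheta\in\Theta$, $\mathbb P^\pi_\vartheta$ is the law of the continuous-time Markov chain $(S_t)_{t\ge0}$ on $\mathcal S$ with initial distribution $\rho$ and generator $\lambda^\pi_{ss',\vartheta}:=\sum_{a\in\mathcal A_s}\pi(a|s)\lambda^a_{ss',\vartheta}$; $\mathbb E_\rho^{\mathbb P^\pi_\vartheta}$ is the corresponding expectation. The reference policy $\mu:\mathcal S\to\mathcal P(\mathcal A)$ satisfies $\operatorname{supp}\mu(\cdot|s)=\mathcal A_s$ for all $s$, and $\mathrm{KL}(\pi\|\mu)(s):=\sum_{a\in\mathcal A_s}\pi(a|s)\log\frac{\pi(a|s)}{\mu(a|s)}$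 with the convention $0\log(0/x)=0$. The normalized discounted state occupancy measure is $\bar{\mathrm d}^\pi_{\rho,\vartheta}(s):=r\,\mathbb E_\rho^{\mathbb P^\pi_\vartheta}\big[\int_0^\infty e^{-rt}\mathbf 1_{\{S_t=s\}}\,\mathrm dt\big]$, $s\in\mathcal S$. Conventions: terms with $\bar{\mathrm d}^\pi_{\rho,\theta}(s)=0$ contribute $0$ to the sum over $s$; if $\bar{\mathrm d}^\pi_{\rho,\theta}(s)>0=\bar{\mathrm d}^\pi_{\rho,\tilde\theta}(s)$ then $f_{\theta,\tilde\theta}(s,a)=+\infty$ (so $\tilde\theta$ is not in the set). The infimum over the empty set is $+\infty$. *)

(* Defs.v *)
From HB Require Import structures.
From mathcomp Require Import all_boot all_order all_algebra.
From mathcomp Require Import all_classical all_reals all_analysis.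

Set Implicit Arguments.
Unset Strict Implicit.
Unset Printing Implicit Defensive.

Import Order.TTheory GRing.Theory Num.Theory.
Import numFieldNormedType.Exports.

Local Open Scope classical_set_scope.
Local Open Scope ring_scope.

Definition prob_dist (R : realType) (T : finType) (p : T -> R) : Prop :=
  (forall x, 0 <= p x) /\ \sum_(x : T) p x = 1.

Section Model.
Variables (R : realType) (S A : finType).
Variable av : S -> {set A}.

(* [pi s a] stands for pi(a|s). *)
Definition policy (pi : S -> A -> R) : Prop :=
  forall s, prob_dist (pi s) /\ \sum_(a in av s) pi s a = 1.

(* [mu s a] stands for mu(a|s); the support of mu(.|s) is exactly A_s. *)
Definition reference_policy (mu : S -> A -> R) : Prop :=
  forall s, prob_dist (mu s) /\ [set a | 0 < mu s a]%SET = av s.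

(* [lam a s s'] stands for lambda^a_{ss'}; it is constrained only for a in A_s. *)
Definition transition_rates (lam : A -> S -> S -> R) : Prop :=
  forall s a, a \in av s ->
    (forall s', s' != s -> 0 <= lam a s s') /\
    lam a s s = - \sum_(s' : S | s' != s) lam a s s'.

Definition policy_generator (lam : A -> S -> S -> R) (pi : S -> A -> R)
    (s s' : S) : R :=
  \sum_(a in av s) pi s a * lam a s s'.

Definition KL (pi mu : S -> A -> R) (s : S) : R :=
  \sum_(a in av s) pi s a * ln (pi s a / mu s a).

Definition policy_mean (pi : S -> A -> R) (g : S -> A -> R) (s : S) : R :=
  \sum_(a in av s) pi s a * g s a.

End Model.

(* The (s, s') entry of exp(t Q), as the sum of the exponential series. *)
Definition transition_semigroup (R : realType) (S : finType) (Q : S -> S -> R)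
    (t : R) (s s' : S) : R :=
  let M : 'M[R]_#|S| := \matrix_(i, j) Q (enum_val i) (enum_val j) in
  limn (series (fun k : nat =>
    t ^+ k / k`!%:R * (M ^+ k) (enum_rank s) (enum_rank s'))).

(* Under the probability P, X is a continuous-time Markov chain with initial
   distribution rho and generator Q: its paths are right-continuous for the
   discrete topology on S and its finite-dimensional distributions are those
   given by rho and the semigroup exp(t Q). Only times t >= 0 matter. *)
Definition is_ctmc (R : realType) (S : finType) (d : measure_display)
    (Omega : measurableType d) (P : probability Omega R) (X : R -> Omega -> S)
    (rho : S -> R) (Q : S -> S -> R) : Prop :=
  [/\ (forall (t : R) (s : S), 0 <= t -> measurable [set w | X t w = s]),
      (forall (w : Omega) (t : R), 0 <= t ->
         exists2 e : R, 0 < e & forall u, t <= u < t + e -> X u w = X t w) &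
      (forall (n : nat) (t : nat -> R) (s : nat -> S),
         t 0%N = 0 -> (forall i, t i <= t i.+1) ->
         P [set w | forall i, (i <= n)%N -> X (t i) w = s i] =
         (rho (s 0%N) * \prod_(i < n)
            transition_semigroup Q (t i.+1 - t i) (s i) (s i.+1))%:E)].

Section Discounted.
Variables (R : realType) (S A : finType).
Variables (d : measure_display) (Omega : measurableType d).
Variables (r : R) (X : R -> Omega -> S).

(* E[ int_0^oo e^{-rt} g(S_t) dt ] *)
Definition discounted_expectation (P : probability Omega R) (g : S -> R)
    : \bar R :=
  ('E_P[(fun w => \int[lebesgue_measure]_(t in `[0, +oo[)
                   (expR (- r * t) * g (X t w)))%R])%E.

(* The expectation is finite (at most 1 / r), so [fine] loses nothing. *)
Definition occupancy (P : probability Omega R) (s : S) : R :=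
  r * fine (discounted_expectation P (fun s' => (s' == s)%:R)).

(* [P0], [R0] are the law and reward under the baseline parameter, [P1], [R1]
   those under the alternative one. Where the alternative occupancy vanishes the
   value is +oo; if the baseline occupancy vanishes as well, this is harmless in
   [adversary_set], since 0 * +oo = 0 in \bar R. *)
Definition deviation (P0 P1 : probability Omega R) (R0 R1 : S -> A -> R)
    (s : S) (a : A) : \bar R :=
  if occupancy P1 s == 0 then +oo%E
  else (ln (occupancy P0 s / occupancy P1 s) - ln (R1 s a / R0 s a))%:E.

(* [Pr th] is the law of the chain under parameter th for the policy at hand. *)
Definition adversary_set (Theta : Type) (av : S -> {set A})
    (Pr : Theta -> probability Omega R) (rew : Theta -> S -> A -> R)
    (mu : S -> A -> R) (tau eps : R) (theta : Theta) : set Theta :=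
  [set th : Theta |
    (tau%:E * lne (\sum_(s : S) (occupancy (Pr theta) s)%:E *
       \sum_(a in av s) (mu s a)%:E *
         expeR (deviation (Pr theta) (Pr th) (rew theta) (rew th) s a
                * (tau^-1)%:E)) <= eps%:E)%E].

End Discounted.

(* Main.v *)
(* Discounted expectations are integrals against the occupancy measure:
   E[int e^{-rt} g(S_t) dt] = r^-1 sum_s d(s) g(s). Writing w = d_theta (x) pi, a
   probability on state-action pairs, and f for the deviation of an adversary th,
   d_th R_th = d_theta R_theta e^{-f} wherever d_theta > 0, so Jensen's inequality
   for exp bounds the return under th below by exp(sum w (log R_theta - f)) / r.
   The Donsker-Varadhan inequality, which is Jensen again after the change of
   measure from pi to mu, gives
   sum w f <= tau sum d_theta KL + tau log sum d_theta mu e^{f/tau}, and the last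
   term is at most eps on the adversary set. *)
Require Import Defs.
From HB Require Import structures.
From mathcomp Require Import all_boot all_order all_algebra.
From mathcomp Require Import all_classical all_reals all_analysis.
From mathcomp Require Import measurable_realfun.
From mathcomp Require Import ring lra.

Import Order.TTheory GRing.Theory Num.Theory.
Import numFieldNormedType.Exports.

Local Open Scope classical_set_scope.
Local Open Scope ring_scope.

(** * Joint measurability of the process in time and path *)

(* By right-continuity X(t) is the eventual value of X at the first grid point
   (k+1)/(n+1) strictly after t, so the set is a lim inf of countable unions of
   rectangles. Time is typed by [measurableTypeR R] since this is the display
   carried by [lebesgue_measure]. *)
Lemma measurable_right_continuous_process (R : realType) (S : finType)
    (d : measure_display) (Omega : measurableType d) (X : R -> Omega -> S) :
  (forall t s, 0 <= t -> measurable [set w | X t w = s]) ->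
  (forall w t, 0 <= t ->
     exists2 e : R, 0 < e & forall u, t <= u < t + e -> X u w = X t w) ->
  forall s, measurable
    [set p : measurableTypeR R * Omega | 0 <= p.1 /\ X p.1 p.2 = s].
Proof.
move=> mX rcX s.
pose node n k : R := k%:R / n.+1%:R.
have node_ge0 n k : 0 <= node n k by rewrite divr_ge0.
pose C n := \bigcup_k
  (`[node n k, node n k.+1[%classic `*` [set w | X (node n k.+1) w = s]).
have -> : [set p : measurableTypeR R * Omega | 0 <= p.1 /\ X p.1 p.2 = s] =
          \bigcup_m \bigcap_n C (m + n)%N.
  have frozen t w : 0 <= t -> exists m, forall n k, (m <= n)%N ->
      node n k <= t < node n k.+1 -> X (node n k.+1) w = X t w.
    move=> t0; have [e e0 rct] := rcX w t t0.
    (* For [n] at least the integer part of 1/e the mesh 1/(n+1) is below [e], so the right end of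
       the cell containing [t] lies before t + e. *)
    exists (Num.trunc e^-1) => n k mn /andP[kt tk]; apply: rct.
    rewrite (ltW tk)/=.
    have -> : node n k.+1 = node n k + n.+1%:R^-1.
      by rewrite /node -natr1 mulrDl mul1r.
    apply: ler_ltD => //; rewrite invf_plt ?posrE//.
    apply: (lt_le_trans (truncnS_gt _)).
    by rewrite ler_nat ltnS.
  apply/seteqP; split => [[t w]/= [t0 Xs]|[t w] /= [m _ Cm]].
    have [m Xm] := frozen t w t0; exists m => // n _.
    have tk : node (m + n)%N (Num.trunc (t * (m + n).+1%:R)) <= t <
              node (m + n)%N (Num.trunc (t * (m + n).+1%:R)).+1.
      rewrite /node ler_pdivrMr// ltr_pdivlMr//.
      by apply: truncn_itv; rewrite mulr_ge0.
    exists (Num.trunc (t * (m + n).+1%:R)) => //; split => /=.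
      by rewrite in_itv.
    by rewrite (Xm _ _ _ tk) ?leq_addr.
  have t0 : 0 <= t.
    have [k _ [/= + _]] := Cm 0%N I.
    by rewrite in_itv/= => /andP[+ _]; apply: le_trans.
  split=> //; have [m' Xm] := frozen t w t0.
  (* Level m + m' is past [m], where [Cm] applies, and past [m'], where the node value is already
     X(t). *)
  have [k _ [/= + <-]] := Cm m' I; rewrite in_itv/= => tk.
  by rewrite (Xm _ _ _ tk) ?leq_addl.
apply: bigcup_measurable => m _; apply: bigcap_measurable => // n _.
apply: bigcup_measurable => k _; apply: measurableX; first exact: measurable_itv.
exact: mX.
Qed.

Lemma Rintegral_lincomb {d : measure_display} {T : measurableType d}
    {R : realType} (mu : {measure set T -> \bar R}) (D : set T) (I : finType)
    (c : I -> R) (f : I -> T -> R) :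
  measurable D -> (forall i, mu.-integrable D (EFin \o f i)) ->
  \int[mu]_(x in D) (\sum_i c i * f i x) = \sum_i c i * \int[mu]_(x in D) f i x.
Proof.
move=> mD intf; rewrite /Rintegral.
have intcf i : mu.-integrable D (fun x => (c i * f i x)%:E).
  exact: (integrableZl mD (c i) (intf i)).
under eq_integral do rewrite -sumEFin.
rewrite integral_sum// -sum_fine => [|i _]; last exact: integrable_fin_num.
by apply: eq_bigr => i _; rewrite -RintegralZl.
Qed.

(** * The discount factor as a multiple of the exponential density *)

Section exponential_clock.
Context {R : realType} (r : R).
Hypothesis r_gt0 : 0 < r.

Let D : set R := `[0, +oo[%classic.

Let expE : {in D, (fun t => expR (- r * t)) =1
                   fun t => r^-1 * exponential_pdf r t}.
Proof.
move=> t; rewrite inE /D/= in_itv/= andbT => t0.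
by rewrite exponential_pdfE// mulKf ?gt_eqF.
Qed.

Let integrable_pdf : lebesgue_measure.-integrable D (EFin \o exponential_pdf r).
Proof.
apply: integrableS (integrable_exponential_pdf r_gt0) => //.
exact: measurable_itv.
Qed.

Lemma integrable_expRN :
  lebesgue_measure.-integrable D (EFin \o fun t => expR (- r * t)).
Proof.
have mD : measurable (D : set (measurableTypeR R)) by exact: measurable_itv.
have := integrableZl mD r^-1 integrable_pdf.
apply: eq_integrable => //.
by move=> t tD /=; rewrite (expE t).
Qed.

Lemma Rintegral_expRN : \int[lebesgue_measure]_(t in D) expR (- r * t) = r^-1.
Proof.
transitivity (\int[lebesgue_measure]_(t in D) (r^-1 * exponential_pdf r t)).
  by apply: eq_Rintegral; exact: expE.
rewrite RintegralZl//; last exact: measurable_itv.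
(* The density vanishes at negative times, so its mass on [D] is its total mass 1. *)
rewrite /Rintegral [X in fine X](_ : _ = 1%E) ?mulr1//.
rewrite -(integral_exponential_pdf r_gt0).
rewrite [RHS]integral_mkcond [LHS]integral_mkcond/=.
apply: eq_integral => t _; rewrite /patch/= in_setT; case: ifPn => // tD.
rewrite lt0_exponential_pdf//; move: tD.
by rewrite notin_setE /D/= in_itv/= andbT => /negP; rewrite -ltNge.
Qed.

End exponential_clock.

(** * Discounted expectations and the occupancy measure *)

Section discounted_process.
Context {R : realType} {S : finType} {d : measure_display}
  {Omega : measurableType d} (P : probability Omega R) (X : R -> Omega -> S)
  (r : R).
Hypothesis r_gt0 : 0 < r.
Hypothesis mX : forall t s, 0 <= t -> measurable [set w | X t w = s].
Hypothesis rcX : forall w t, 0 <= t ->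
  exists2 e : R, 0 < e & forall u, t <= u < t + e -> X u w = X t w.

Let D : set R := `[0, +oo[%classic.
Let h s w t : R := expR (- r * t) * (X t w == s)%:R.
(** The discounted time that the path [w] spends in [s]. *)
Let J s w : R := \int[lebesgue_measure]_(t in D) h s w t.

(** Tonelli needs this joint measurability to make [J s] measurable in the path. It reduces to that
    of the set [B], whose indicator is multiplied by the discount factor. *)
Let measurable_h s :
  measurable_fun setT (fun p : measurableTypeR R * Omega => (h s p.2 \_ D) p.1).
Proof.
pose B := [set p : measurableTypeR R * Omega | 0 <= p.1 /\ X p.1 p.2 = s].
have mB : measurable B by exact: measurable_right_continuous_process.
rewrite (_ : (fun _ => _) =
             fun p : measurableTypeR R * Omega => expR (- r * p.1) * \1_B p).
  apply: measurable_funM; last exact: measurable_indic.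
  apply: measurableT_comp => //.
  by apply: measurable_funM => //; exact: measurable_fst.
apply/funext => -[t w] /=; rewrite patchE indicE /D.
have [t0|t0] := boolP (0 <= t).
  rewrite mem_set/= ?in_itv/= ?t0// /h.
  by case: eqP => Xs; [rewrite mem_set|rewrite memNset// => -[]].
rewrite !memNset ?mulr0//= ?in_itv/= ?(negbTE t0)// => -[].
by rewrite (negbTE t0).
Qed.

Let mD : measurable (D : set (measurableTypeR R)).
Proof. exact: measurable_itv. Qed.

Let integrable_h s w : lebesgue_measure.-integrable D (EFin \o h s w).
Proof.
apply: le_integrable (integrable_expRN r r_gt0) => //.
  apply/measurable_EFinP.
  apply/(measurable_restrictT _ mD).
  exact: measurable_fun_pair1 w (measurable_h s).
move=> t _ /=; rewrite lee_fin /h normrM ler_piMr//.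
by case: (_ == _); rewrite ?normr1 ?normr0.
Qed.

Let J_ge0 s w : 0 <= J s w.
Proof. by apply: Rintegral_ge0 => t _; rewrite mulr_ge0 ?expR_ge0. Qed.

Let J_le s w : J s w <= r^-1.
Proof.
rewrite -(Rintegral_expRN r r_gt0); apply: le_Rintegral => //.
  exact: integrable_expRN.
by move=> t _; rewrite /h ler_piMr ?expR_ge0//; case: (_ == _).
Qed.

Let measurable_J s : measurable_fun setT (J s).
Proof.
have mF : measurable_fun setT (fubini_G lebesgue_measure
    (fun p : measurableTypeR R * Omega => ((h s p.2 \_ D) p.1)%:E)).
  apply: measurable_fun_fubini_tonelli_G; first exact/measurable_EFinP.
  move=> p; rewrite lee_fin patchE; case: ifP => // _.
  by rewrite mulr_ge0 ?expR_ge0.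
rewrite (_ : J s = fine \o fubini_G lebesgue_measure
    (fun p : measurableTypeR R * Omega => ((h s p.2 \_ D) p.1)%:E)).
  exact: measurableT_comp.
by apply/funext => w; rewrite /J Rintegral_mkcond.
Qed.

Let integrable_J s : P.-integrable setT (EFin \o J s).
Proof.
apply: measurable_bounded_integrable => //.
  by rewrite [X in (X < _)%E]probability_setT ltry.
exists r^-1; split; first exact: num_real.
move=> x rx w _ /=; rewrite ger0_norm// (le_trans (J_le s w))//; exact: ltW.
Qed.

(** Since [S] is finite, g(X_t) is the sum over s of g(s) times the indicator of X_t = s. *)
Let path_integral (g : S -> R) w :
  \int[lebesgue_measure]_(t in D) (expR (- r * t) * g (X t w)) =
  \sum_s g s * J s w.
Proof.
transitivity (\int[lebesgue_measure]_(t in D) \sum_s g s * h s w t); last first.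
  exact: (Rintegral_lincomb lebesgue_measure _ _ _ _ mD (integrable_h^~ w)).
apply: eq_Rintegral => t _; rewrite (bigD1 (X t w))//= big1 ?addr0 => [|s sX].
  by rewrite /h eqxx mulr1 mulrC.
by rewrite /h eq_sym (negbTE sX) mulr0 mulr0.
Qed.

Let m s : R := \int[P]_w J s w.

Let discounted_m (g : S -> R) :
  discounted_expectation r X P g = (\sum_s g s * m s)%:E.
Proof.
rewrite -Rintegral_lincomb// fineK /discounted_expectation.
  rewrite unlock; apply: eq_integral => w _.
  by rewrite -path_integral.
apply: integrable_fin_num => //.
under eq_fun do rewrite -sumEFin.
apply: integrable_sum => // s _.
exact: (integrableZl measurableT (g s) (integrable_J s)).
Qed.

Let occupancyE s : occupancy r X P s = r * m s.
Proof.
rewrite /occupancy discounted_m/= (bigD1 s)//= eqxx mul1r.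
by rewrite big1 ?addr0// => s' /negbTE ->; rewrite mul0r.
Qed.

Lemma discounted_expectationE (g : S -> R) :
  discounted_expectation r X P g = (r^-1 * \sum_s occupancy r X P s * g s)%:E.
Proof.
rewrite discounted_m mulr_sumr; congr EFin; apply: eq_bigr => s _.
by rewrite occupancyE -mulrA mulKf ?gt_eqF// mulrC.
Qed.

(** On every path the times [J s w] add up to the total discounted time 1/r. *)
Lemma occupancy_dist : prob_dist (occupancy r X P).
Proof.
split=> [s|].
  by rewrite occupancyE mulr_ge0 ?(ltW r_gt0)//; exact: Rintegral_ge0.
have sumJ w : \sum_s 1 * J s w = r^-1.
  rewrite -path_integral -(Rintegral_expRN r r_gt0).
  by apply: eq_Rintegral => t _; rewrite mulr1.
under eq_bigr do rewrite occupancyE -[m _]mul1r.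
rewrite -mulr_sumr -Rintegral_lincomb//.
under eq_Rintegral do rewrite sumJ.
by rewrite Rintegral_cst// [X in fine X]probability_setT/= mulr1 mulfV ?gt_eqF.
Qed.

End discounted_process.

(** * Jensen and Donsker-Varadhan inequalities for finite sums *)

Lemma expR_weighted_sum_le (R : realType) (I : finType) (w g : I -> R) :
  prob_dist w -> expR (\sum_i w i * g i) <= \sum_i w i * expR (g i).
Proof.
(* Average over i the tangent-line bound expR G (1 + (g i - G)) <= expR (g i). *)
move=> [w0 w1]; set G := \sum_i w i * g i.
have -> : expR G = \sum_i w i * (expR G * (1 + (g i - G))).
  transitivity (\sum_i (expR G * (1 - G) * w i + expR G * (w i * g i))).
    by rewrite big_split/= -!mulr_sumr w1 -/G; ring.
  by apply: eq_bigr => i _; ring.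
apply: ler_sum => i _; apply: ler_wpM2l => //.
by rewrite -[g i in leRHS](subrKC G) expRD ler_wpM2l ?expR_ge0 ?expR_ge1Dx.
Qed.

Section finite_model.
Context {R : realType} {S A : finType} (av : S -> {set A}).
Variables (pi mu : S -> A -> R).
Hypothesis pi_policy : policy av pi.
Hypothesis mu_ref : reference_policy av mu.

Let pi_ge0 s a : 0 <= pi s a. Proof. by have [[]] := pi_policy s. Qed.

Let mu_gt0 s a : a \in av s -> 0 < mu s a.
Proof. by have [_ <-] := mu_ref s; rewrite inE. Qed.

(** The cut-off outside A_s turns sums whose range depends on s into sums over the product S * A, so
    that Jensen is applied only once. *)
Let state_action (nu : S -> R) (p : S * A) : R :=
  if p.2 \in av p.1 then nu p.1 * pi p.1 p.2 else 0.

Let state_actionE (nu : S -> R) (g : S -> A -> R) :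
  \sum_p state_action nu p * g p.1 p.2 = \sum_s nu s * policy_mean av pi g s.
Proof.
rewrite (eq_bigr (fun p => state_action nu (p.1, p.2) * g p.1 p.2)); last first.
  by move=> [].
rewrite -(pair_bigA _ (fun s a => state_action nu (s, a) * g s a))/=.
apply: eq_bigr => s _; rewrite /policy_mean mulr_sumr [RHS]big_mkcond/=.
apply: eq_bigr => a _; rewrite /state_action/=.
by case: ifP => _; rewrite ?mul0r// mulrA.
Qed.

Let state_action_dist (nu : S -> R) : prob_dist nu -> prob_dist (state_action nu).
Proof.
move=> [nu0 nu1]; split=> [p|].
  by rewrite /state_action; case: ifP => // _; rewrite mulr_ge0.
under eq_bigr do rewrite -[state_action _ _]mulr1.
rewrite (state_actionE nu (fun _ _ => 1)) -[RHS]nu1; apply: eq_bigr => s _.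
rewrite [policy_mean _ _ _ _](_ : _ = 1) ?mulr1//.
have [_ pi1] := pi_policy s; rewrite -[RHS]pi1.
by apply: eq_bigr => a _; rewrite mulr1.
Qed.

Lemma expR_policy_mean_le (nu : S -> R) (g : S -> A -> R) : prob_dist nu ->
  expR (\sum_s nu s * policy_mean av pi g s) <=
  \sum_s nu s * policy_mean av pi (fun s a => expR (g s a)) s.
Proof.
move=> nu_dist; rewrite -!state_actionE.
by apply: expR_weighted_sum_le; exact: state_action_dist.
Qed.

(** Jensen for g - ln(pi/mu), whose exponential is e^g mu/pi: the weight pi cancels and leaves
    mu. *)
Lemma donsker_varadhan (nu : S -> R) (g : S -> A -> R) : prob_dist nu ->
  expR (\sum_s nu s * (policy_mean av pi g s - KL av pi mu s)) <=
  \sum_s nu s * \sum_(a in av s) mu s a * expR (g s a).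
Proof.
move=> nu_dist.
have -> : \sum_s nu s * (policy_mean av pi g s - KL av pi mu s) =
    \sum_s nu s * policy_mean av pi (fun s a => g s a - ln (pi s a / mu s a)) s.
  apply: eq_bigr => s _; congr (_ * _); rewrite /policy_mean /KL -sumrB.
  by apply: eq_bigr => a _; rewrite mulrBr.
apply: (le_trans (expR_policy_mean_le _ _ nu_dist)).
apply: ler_sum => s _; apply: ler_wpM2l; first exact: nu_dist.1.
apply: ler_sum => a aP; have mu0 := mu_gt0 _ _ aP.
(* An action of zero probability contributes 0 on the left and a nonnegative term on the right. *)
have [->|pi0] := eqVneq (pi s a) 0; first by rewrite mul0r mulr_ge0 ?expR_ge0 ?ltW.
have {}pi0 : 0 < pi s a by rewrite lt0r pi0 pi_ge0.
rewrite expRB lnK ?posrE ?divr_gt0// invf_div mulrCA [_ * (mu _ _ / _)]mulrCA.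
by rewrite mulfV ?gt_eqF// mulr1 mulrC.
Qed.

(** Here [f] is real-valued: [ac] stands in for the infinite case of [deviation], and the constraint
    is exponentiated so that it chains with [donsker_varadhan] at f/tau. *)
Lemma robust_return_ge (nu0 nu1 : S -> R) (R0 R1 : S -> A -> R) (tau eps : R) :
  let f s a := ln (nu0 s / nu1 s) - ln (R1 s a / R0 s a) in
  prob_dist nu0 -> prob_dist nu1 -> (forall s, 0 < nu0 s -> 0 < nu1 s) ->
  (forall s a, 0 < R0 s a) -> (forall s a, 0 < R1 s a) -> 0 < tau ->
  \sum_s nu0 s * (\sum_(a in av s) mu s a * expR (f s a / tau)) <=
    expR (eps / tau) ->
  expR (\sum_s nu0 s * (policy_mean av pi (fun s a => ln (R0 s a)) s
                        - tau * KL av pi mu s) - eps) <=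
  \sum_s nu1 s * policy_mean av pi R1 s.
Proof.
move=> f nu0_dist nu1_dist ac R0_gt0 R1_gt0 tau_gt0.
move=> /(le_trans (donsker_varadhan _ (fun s a => f s a / tau) nu0_dist)).
rewrite ler_expR ler_pdivlMr// mulr_suml => dv.
(* Jensen leads to the middle term, because [dv] bounds the nu0-average of (mean of f) - tau KL by
   eps. *)
apply: (@le_trans _ _ (\sum_s nu0 s *
    policy_mean av pi (fun s a => expR (ln (R0 s a) - f s a)) s)).
  apply: le_trans (expR_policy_mean_le _ _ nu0_dist); rewrite ler_expR lerBlDr.
  rewrite -lerBlDl; apply: le_trans dv; rewrite -sumrB.
  apply: ler_sum => s _; rewrite -mulrBr -mulrA; apply: ler_wpM2l.
    exact: nu0_dist.1.
  have -> : policy_mean av pi (fun s a => ln (R0 s a) - f s a) s =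
      policy_mean av pi (fun s a => ln (R0 s a)) s - policy_mean av pi f s.
    by rewrite /policy_mean -sumrB; apply: eq_bigr => a _; rewrite mulrBr.
  have -> : policy_mean av pi (fun s a => f s a / tau) s =
      policy_mean av pi f s / tau.
    by rewrite /policy_mean mulr_suml; apply: eq_bigr => a _; rewrite mulrA.
  rewrite mulrBl divfK ?gt_eqF//; lra.
apply: ler_sum => s _.
have pm_ge0 : 0 <= policy_mean av pi R1 s.
  by apply: sumr_ge0 => a _; rewrite mulr_ge0 ?pi_ge0 ?ltW.
(* States without baseline mass vanish on the left, while positive rewards keep the right side
   nonnegative. *)
have [->|nu00] := eqVneq (nu0 s) 0.
  by rewrite mul0r mulr_ge0//; exact: nu1_dist.1.
have {}nu00 : 0 < nu0 s by rewrite lt0r nu00 nu0_dist.1.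
have nu10 := ac _ nu00.
rewrite /policy_mean !mulr_sumr; apply: ler_sum => a _.
have fE : ln (R0 s a) - f s a = ln (nu1 s / nu0 s * R1 s a).
  rewrite /f [in RHS]lnM ?posrE ?divr_gt0// !ln_div ?posrE//; ring.
rewrite fE lnK ?posrE ?mulr_gt0 ?invr_gt0//.
by rewrite le_eqVlt; apply/orP; left; apply/eqP; field; rewrite gt_eqF.
Qed.

End finite_model.

(** * From the extended-real constraint to real bounds *)

Section adversary.
Context {R : realType} {S A : finType} {d : measure_display}
  {Omega : measurableType d} {Theta : Type}.
Variables (r : R) (X : R -> Omega -> S) (av : S -> {set A}).
Variables (Pr : Theta -> probability Omega R) (rew : Theta -> S -> A -> R).
Variables (mu : S -> A -> R) (tau eps : R) (theta th : Theta).
Hypothesis av_nonempty : forall s, av s != finset.set0.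
Hypothesis mu_ref : reference_policy av mu.
Hypothesis tau_gt0 : 0 < tau.
Hypothesis occ_ge0 : forall th s, 0 <= occupancy r X (Pr th) s.
Hypothesis th_adv : adversary_set r X av Pr rew mu tau eps theta th.

Let nu := occupancy r X (Pr theta).
Let nu' := occupancy r X (Pr th).
Let f s a := deviation r X (Pr theta) (Pr th) (rew theta) (rew th) s a.
Let Z : \bar R := (\sum_s (nu s)%:E *
  \sum_(a in av s) (mu s a)%:E * expeR (f s a * (tau^-1)%:E))%E.

(** Exponentiating the constraint is safe: an infinite [Z] would violate it as tau > 0, and where
    the logarithm is degenerate, [Z] is at most 0. *)
Let Z_le : (Z <= (expR (eps / tau))%:E)%E.
Proof.
have : (tau%:E * lne Z <= eps%:E)%E by exact: th_adv.
case: Z => [z| |_]; last exact: leNye.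
  rewrite [lne _]/=; case: ifPn => [z0 _|].
    by rewrite lee_fin (le_trans z0)// expR_ge0.
  rewrite -ltNge => z0; rewrite -EFinM !lee_fin => zeps.
  by rewrite -[leLHS]lnK// ler_expR ler_pdivlMr// mulrC.
by rewrite [lne _]/= gt0_muley ?lte_fin// leye_eq.
Qed.

Let mu_ge0 s a : 0 <= mu s a. Proof. by have [[]] := mu_ref s. Qed.

Let term_ge0 s a : (0 <= (mu s a)%:E * expeR (f s a * (tau^-1)%:E))%E.
Proof. by rewrite mule_ge0 ?lee_fin ?expeR_ge0. Qed.

(** Otherwise the deviation is infinite at s; some action of A_s has positive mu-weight, so [Z]
    would be infinite, against [Z_le]. *)
Lemma adversary_occupancy_gt0 s :
  0 < occupancy r X (Pr theta) s -> 0 < occupancy r X (Pr th) s.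
Proof.
move=> nu_gt0; rewrite lt0r occ_ge0 andbT; apply/negP => nu'0.
have /set0Pn[a aP] := av_nonempty s.
have mu_gt0 : 0 < mu s a by have [_ avE] := mu_ref s; move: aP; rewrite -avE inE.
suff Zy : Z = +oo%E by move: Z_le; rewrite Zy leye_eq.
(* +oo absorbs a summand only if that summand is not -oo, hence the nonnegativity checks below. *)
have ney (x : \bar R) : (0 <= x)%E -> (+oo + x = +oo)%E by case: x.
have fy : f s a = +oo%E by rewrite /f /deviation nu'0.
rewrite /Z (bigD1 s)//= (bigD1 a)//= fy.
rewrite gt0_mulye ?lte_fin ?invr_gt0//=. rewrite gt0_muley ?lte_fin//.
rewrite ney; last by apply: sume_ge0 => b _; exact: term_ge0.
rewrite gt0_muley ?lte_fin// ney//.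
apply: sume_ge0 => s' _; rewrite mule_ge0 ?lee_fin ?occ_ge0//.
by apply: sume_ge0 => b _; exact: term_ge0.
Qed.

(** The deviation can be infinite only where [nu] vanishes, and there both sums have a zero term
    because 0 * +oo = 0. *)
Lemma adversary_exp_moment_le :
  \sum_s nu s * (\sum_(a in av s) mu s a *
     expR ((ln (nu s / nu' s) - ln (rew th s a / rew theta s a)) / tau)) <=
  expR (eps / tau).
Proof.
rewrite -lee_fin; apply: le_trans Z_le; rewrite le_eqVlt; apply/orP; left.
apply/eqP; rewrite /Z -sumEFin; apply: eq_bigr => s _; rewrite EFinM.
have [->|nu0] := eqVneq (nu s) 0; first by rewrite !mul0e.
have nu'0 : 0 < nu' s.
  by apply: adversary_occupancy_gt0; rewrite lt0r nu0 occ_ge0.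
congr (_ * _)%E; rewrite -sumEFin; apply: eq_bigr => a _.
by rewrite EFinM /f /deviation gt_eqF.
Qed.

End adversary.

(** * Lower bound on the robust return *)

Theorem theorem3p2 (R : realType) (S A : finType) (av : S -> {set A})
  (Theta : Type) (lam : Theta -> A -> S -> S -> R) (rew : Theta -> S -> A -> R)
  (theta : Theta) (rho : S -> R) (r : R) (mu : S -> A -> R)
  (d : measure_display) (Omega : measurableType d) (X : R -> Omega -> S)
  (Pr : (S -> A -> R) -> Theta -> probability Omega R)
  (av_nonempty : forall s, av s != finset.set0)
  (lam_rates : forall th, transition_rates av (lam th))
  (rew_gt0 : forall th s a, 0 < rew th s a)
  (rho_dist : prob_dist rho)
  (r_gt0 : 0 < r)
  (mu_ref : reference_policy av mu)
  (Pr_law : forall pi th, policy av pi ->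
     is_ctmc (Pr pi th) X rho (policy_generator av (lam th) pi))
  (pi : S -> A -> R) (tau eps : R)
  (pi_policy : policy av pi) (tau_gt0 : 0 < tau) (eps_ge0 : 0 <= eps) :
  (expeR (r%:E * discounted_expectation r X (Pr pi theta)
                   (fun s => policy_mean av pi (fun s' a => ln (rew theta s' a)) s
                             - tau * KL av pi mu s)%R
          - eps%:E - (ln r)%:E)
   <= ereal_inf
        [set discounted_expectation r X (Pr pi th) (policy_mean av pi (rew th))
        | th in adversary_set r X av (Pr pi) rew mu tau eps theta])%E.
Proof.
(* Measurability and right-continuity concern [X] alone, so reading them off at [theta] serves every
   parameter. *)
have [mX rcX _] := Pr_law _ theta pi_policy.
have occ_dist th : prob_dist (occupancy r X (Pr pi th)) by exact: occupancy_dist.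
apply/ereal_infP => _ [th th_adv <-].
rewrite !discounted_expectationE// -EFinM mulVKf ?gt_eqF// lee_fin.
(* The term -ln r becomes a factor 1/r, which cancels the one relating returns to occupancies. *)
rewrite expRB lnK// mulrC ler_pM2l ?invr_gt0//.
have occ_ge0 th' s : 0 <= occupancy r X (Pr pi th') s by exact: (occ_dist _).1.
apply: (robust_return_ge av pi mu) => //.
- exact: adversary_occupancy_gt0 th_adv.
- exact: adversary_exp_moment_le th_adv.
Qed.
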